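(* For every $0\le k\le \binom n2$, $$R_k\cong\bigoplus_{S} R_{\lambda_S}$$ as $S_n$-modules, where the sum is over all subsets $S\subseteq[n-1]$ with $\sum_{i\in S} i=k$.
   Context: $P_n=\mathbf{Q}[x_1,\dots,x_n]$ with $S_n$ acting by permuting variables ($\tau(x_i)=x_{\tau(i)}$). $I_n$ is the ideal generated by the symmetric polynomials without constant term; $P_n/I_n$ is the coinvariant algebra, $\psi:P_n\to P_n/I_n$ the canonical projection, and $R_k$ its $k$-th homogeneous component. For a monomial $m=\prod x_i^{p_i}$, its exponent partition $\lambda(m)$ is $(p_1,\dots,p_n)$ rearranged in weakly decreasing order. For a partition $\lambda$ with at most $n$ parts, $P^{\trianglelefteq}_\lambda$ (resp. $P^{\triangleleft}_\lambda$) is the $\mathbf{Q}$-span of monomials $m$ with $\lambda(m)$ dominated by $\lambda$ (resp. strictly dominated by $\lambda$) in dominance order, and $R_\lambda:=\psi(P^{\trianglelefteq}_\lambda)/\psi(P^{\triangleleft}_\lambda)$, an $S_n$-module. For $S\subseteq[n]$, $\lambda_S=(\lambda_1,\dots,\lambda_n)$ with $\lambda_i=|S\cap\{i,\dots,n\}|$. *)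

(* Defs.v *)
From HB Require Import structures.
From mathcomp Require Import all_boot all_order all_fingroup all_algebra.
From mathcomp Require Import mpoly boolp generic_quotient ring_quotient.

Set Implicit Arguments.
Unset Strict Implicit.
Unset Printing Implicit Defensive.

Import GRing.Theory.

Local Open Scope ring_scope.

(* Linear representations of a finite group, possibly of infinite dimension.
   As everywhere in MathComp, groups act on the right:
   x acted on by g * h is (x acted on by g) acted on by h.  Since the product
   in 'S_n is (s * t) i = t (s i), such a right action of 'S_n is the same
   thing as a left action for the usual composition of permutations. *)

Record repType (F : fieldType) (gT : finGroupType) := RepType {
  rep_sort :> lmodType F;
  rep_act : {action gT &-> rep_sort};
  rep_act_linear : forall g, linear (rep_act^~ g)
}.

Section Representations.

Variables (F : fieldType) (gT : finGroupType).
Implicit Types M N : repType F gT.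

Lemma rep_actM M (x : M) g h :
  rep_act M x (g * h)%g = rep_act M (rep_act M x g) h.
Proof. by case: (rep_act M) => to [_ toM] /=; rewrite toM ?inE. Qed.

Lemma rep_act1 M (x : M) : rep_act M x 1%g = x.
Proof.
have act_inj : left_injective (rep_act M) by case: (rep_act M) => to [].
by apply: (act_inj 1%g); rewrite -rep_actM mulg1.
Qed.

Lemma rep_act0 M g : rep_act M 0 g = 0.
Proof.
have := rep_act_linear g (-1) (0 : M) 0.
by rewrite scaleN1r oppr0 addr0 scaleN1r addNr.
Qed.

Record rep_hom M N := RepHom {
  rep_hom_fun :> {linear M -> N};
  rep_homJ : forall x g,
    rep_hom_fun (rep_act M x g) = rep_act N (rep_hom_fun x) g
}.

Definition rep_iso M N : Prop := exists f : rep_hom M N, bijective f.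

Record subrep M := SubRep {
  subrep_zmod : zmodClosed M;
  subrep_scale : forall a x, x \in subrep_zmod -> a *: x \in subrep_zmod;
  subrep_stable : forall x g, x \in subrep_zmod -> rep_act M x g \in subrep_zmod
}.

Definition subrep_pred M (U : subrep M) : {pred M} := subrep_zmod U.

Coercion subrep_pred : subrep >-> pred_sort.

Lemma subrep_closed M (U : subrep M) : submod_closed (subrep_pred U).
Proof.
split=> [|a x y Ux Uy]; first exact: (rpred0 (subrep_zmod U)).
by apply: (rpredD (S := subrep_zmod U)) => //; apply: subrep_scale.
Qed.

HB.instance Definition _ M (U : subrep M) :=
  GRing.isSubmodClosed.Build F M (subrep_pred U) (subrep_closed U).

Section MkSubrep.

Variables (M : repType F gT) (P : {pred M}).
Hypothesis P_closed : submod_closed P.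
Hypothesis P_stable : forall x g, x \in P -> rep_act M x g \in P.

Definition mk_subrep : subrep M := @SubRep M
  (HB.pack_for (zmodClosed M) (P : M -> bool)
    (GRing.isZmodClosed.Build M P (GRing.submod_closedB P_closed)))
  (GRing.subsemimod_closedZ (GRing.submod_closed_semi P_closed)) P_stable.

End MkSubrep.

Section Sub.

Variables (M : repType F gT) (U : subrep M).

Record sub_sort := SubSort {
  sub_val : M;
  sub_valP : sub_val \in subrep_pred U
}.

HB.instance Definition _ := [isSub for sub_val].
HB.instance Definition _ := [Choice of sub_sort by <:].
HB.instance Definition _ := [SubChoice_isSubLmodule of sub_sort by <:].

Lemma sub_val_linear : linear sub_val.
Proof. exact: (linearP (val : sub_sort -> M)). Qed.

Definition sub_act (x : sub_sort) (g : gT) : sub_sort :=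
  SubSort (subrep_stable g (sub_valP x)).

Lemma sub_act1 : sub_act^~ 1%g =1 id.
Proof. by move=> x; apply/val_inj; rewrite /= rep_act1. Qed.

Lemma sub_actM x : act_morph sub_act x.
Proof. by move=> g h; apply/val_inj; rewrite /= rep_actM. Qed.

Lemma sub_act_linear g : linear (TotalAction sub_act1 sub_actM ^~ g).
Proof. by move=> a x y; apply/val_inj; rewrite /= rep_act_linear. Qed.

Definition sub_rep : repType F gT := RepType sub_act_linear.

HB.instance Definition _ :=
  GRing.isLinear.Build F sub_rep M *:%R (sub_val : sub_rep -> M) sub_val_linear.

Definition sub_incl : rep_hom sub_rep M :=
  @RepHom sub_rep M (sub_val : sub_rep -> M) (fun x g => erefl).

End Sub.

(* The carrier of M / U is the quotient of M by the additive group U, so that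
   when U is an ideal of a ring M it is {ideal_quot U} (see coinvE below). *)
Section Quot.

Variables (M : repType F gT) (U : subrep M).

Definition quot_sort := Quotient.quot (subrep_zmod U).

HB.instance Definition _ := GRing.Zmodule.on quot_sort.

Definition quot_pi (x : M) : quot_sort :=
  (\pi_(Quotient.quot (subrep_zmod U)) x)%qT.

Lemma quot_piP x y : (quot_pi x = quot_pi y) <-> (x - y \in subrep_pred U).
Proof. by split=> [/eqP|?]; last apply/eqP; rewrite /quot_pi -Quotient.idealrBE. Qed.

Lemma quot_piB : {morph quot_pi : x y / x - y}.
Proof. exact: raddfB. Qed.

Lemma quot_piD : {morph quot_pi : x y / x + y}.
Proof. exact: raddfD. Qed.

Lemma quot_reprK x : quot_pi (repr x) = x.
Proof. exact: reprK. Qed.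

Definition quot_scale (a : F) (x : quot_sort) : quot_sort :=
  quot_pi (a *: repr x).

Lemma quot_piZ a x : quot_scale a (quot_pi x) = quot_pi (a *: x).
Proof.
by apply/quot_piP; rewrite -scalerBr rpredZ //; apply/quot_piP/quot_reprK.
Qed.

Lemma quot_scalerA a b x :
  quot_scale a (quot_scale b x) = quot_scale (a * b) x.
Proof. by rewrite -[x]quot_reprK !quot_piZ scalerA. Qed.

Lemma quot_scale1r : left_id 1 quot_scale.
Proof. by move=> x; rewrite -[x]quot_reprK quot_piZ scale1r. Qed.

Lemma quot_scalerDr : right_distributive quot_scale +%R.
Proof.
move=> a x y; rewrite -[x]quot_reprK -[y]quot_reprK -quot_piD !quot_piZ.
by rewrite scalerDr quot_piD.
Qed.

Lemma quot_scalerDl x : {morph quot_scale^~ x : a b / a + b}.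
Proof.
by move=> a b; rewrite -[x]quot_reprK !quot_piZ scalerDl quot_piD.
Qed.

HB.instance Definition _ := GRing.Zmodule_isLmodule.Build F quot_sort
  quot_scalerA quot_scale1r quot_scalerDr quot_scalerDl.

Definition quot_act (x : quot_sort) (g : gT) : quot_sort :=
  quot_pi (rep_act M (repr x) g).

Lemma quot_actE x g : quot_act (quot_pi x) g = quot_pi (rep_act M x g).
Proof.
apply/quot_piP; rewrite -[_ - _]addrC -scaleN1r -rep_act_linear.
apply: subrep_stable; rewrite scaleN1r addrC.
exact/quot_piP/quot_reprK.
Qed.

Lemma quot_act1 : quot_act^~ 1%g =1 id.
Proof. by move=> x; rewrite -[x]quot_reprK quot_actE rep_act1. Qed.

Lemma quot_actM x : act_morph quot_act x.
Proof.
by move=> g h; rewrite -[x]quot_reprK !quot_actE rep_actM.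
Qed.

Lemma quot_pi_linear : linear quot_pi.
Proof. by move=> a x y; rewrite quot_piD -quot_piZ. Qed.

Lemma quot_act_linear g : linear (TotalAction quot_act1 quot_actM ^~ g).
Proof.
move=> a x y; rewrite /= -[x]quot_reprK -[y]quot_reprK -quot_pi_linear.
by rewrite !quot_actE rep_act_linear quot_pi_linear.
Qed.

Definition quot_rep : repType F gT := RepType quot_act_linear.

HB.instance Definition _ :=
  GRing.isLinear.Build F M quot_rep *:%R (quot_pi : M -> quot_rep)
    quot_pi_linear.

Definition quot_proj : rep_hom M quot_rep :=
  @RepHom M quot_rep (quot_pi : M -> quot_rep) (fun x g => esym (quot_actE x g)).

End Quot.

Section ImagePreimage.

Variables (M N : repType F gT) (f : rep_hom M N).

Definition im_pred (U : subrep M) : {pred N} :=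
  fun y => `[< exists2 x, x \in subrep_pred U & y = f x >].

Lemma im_closed U : submod_closed (im_pred U).
Proof.
split=> [|a y z /asboolP[x Ux ->] /asboolP[x' Ux' ->]]; apply/asboolP.
  by exists 0; rewrite ?rpred0 ?linear0.
by exists (a *: x + x'); rewrite ?linearP ?rpredD ?rpredZ.
Qed.

Lemma im_stable U y g : y \in im_pred U -> rep_act N y g \in im_pred U.
Proof.
case/asboolP=> x Ux ->; apply/asboolP.
by exists (rep_act M x g); rewrite ?rep_homJ ?subrep_stable.
Qed.

Definition im_subrep (U : subrep M) : subrep N :=
  mk_subrep (im_closed U) (@im_stable U).

Definition preim_pred (W : subrep N) : {pred M} :=
  [pred x | f x \in subrep_pred W].

Lemma preim_closed W : submod_closed (preim_pred W).
Proof.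
split=> [|a x y]; rewrite !inE ?linear0 ?rpred0 //.
by rewrite linearP => Wx Wy; rewrite rpredD ?rpredZ.
Qed.

Lemma preim_stable W x g : x \in preim_pred W -> rep_act M x g \in preim_pred W.
Proof. by rewrite !inE rep_homJ; apply: subrep_stable. Qed.

Definition preim_subrep (W : subrep N) : subrep M :=
  mk_subrep (preim_closed W) (@preim_stable W).

End ImagePreimage.

(* This is U / (U :&: W), to be used for W contained in U. *)
Definition subquot_rep M (U W : subrep M) : repType F gT :=
  quot_rep (preim_subrep (sub_incl U) W).

Section DirectSum.

Variables (I : finType) (M : I -> repType F gT).

Definition dsum_sort := {dffun forall i, M i}.

HB.instance Definition _ := Choice.on dsum_sort.

Definition dsum_zero : dsum_sort := [ffun i => 0 : M i].
Definition dsum_opp (x : dsum_sort) : dsum_sort := [ffun i => - x i].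
Definition dsum_add (x y : dsum_sort) : dsum_sort := [ffun i => x i + y i].
Definition dsum_scale a (x : dsum_sort) : dsum_sort := [ffun i => a *: x i].
Definition dsum_act (x : dsum_sort) g : dsum_sort :=
  [ffun i => rep_act (M i) (x i) g].

Lemma dsum_addA : associative dsum_add.
Proof. by move=> x y z; apply/ffunP=> i; rewrite !ffunE addrA. Qed.

Lemma dsum_addC : commutative dsum_add.
Proof. by move=> x y; apply/ffunP=> i; rewrite !ffunE addrC. Qed.

Lemma dsum_add0 : left_id dsum_zero dsum_add.
Proof. by move=> x; apply/ffunP=> i; rewrite !ffunE add0r. Qed.

Lemma dsum_addN : left_inverse dsum_zero dsum_opp dsum_add.
Proof. by move=> x; apply/ffunP=> i; rewrite !ffunE addNr. Qed.

HB.instance Definition _ := GRing.isZmodule.Build dsum_sort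
  dsum_addA dsum_addC dsum_add0 dsum_addN.

Lemma dsum_scalerA a b x :
  dsum_scale a (dsum_scale b x) = dsum_scale (a * b) x.
Proof. by apply/ffunP=> i; rewrite !ffunE scalerA. Qed.

Lemma dsum_scale1r : left_id 1 dsum_scale.
Proof. by move=> x; apply/ffunP=> i; rewrite !ffunE scale1r. Qed.

Lemma dsum_scalerDr : right_distributive dsum_scale +%R.
Proof. by move=> a x y; apply/ffunP=> i; rewrite !ffunE scalerDr. Qed.

Lemma dsum_scalerDl x : {morph dsum_scale^~ x : a b / a + b}.
Proof. by move=> a b; apply/ffunP=> i; rewrite !ffunE scalerDl. Qed.

HB.instance Definition _ := GRing.Zmodule_isLmodule.Build F dsum_sort
  dsum_scalerA dsum_scale1r dsum_scalerDr dsum_scalerDl.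

Lemma dsum_act1 : dsum_act^~ 1%g =1 id.
Proof. by move=> x; apply/ffunP=> i; rewrite !ffunE rep_act1. Qed.

Lemma dsum_actM x : act_morph dsum_act x.
Proof. by move=> g h; apply/ffunP=> i; rewrite !ffunE rep_actM. Qed.

Lemma dsum_act_linear g : linear (TotalAction dsum_act1 dsum_actM ^~ g).
Proof. by move=> a x y; apply/ffunP=> i; rewrite !ffunE rep_act_linear. Qed.

Definition dsum_rep : repType F gT := RepType dsum_act_linear.

End DirectSum.

End Representations.

Definition span_pred (F : fieldType) (V : lmodType F) (A : V -> Prop) :
    {pred V} :=
  fun v => `[< exists s : seq (F * V),
    (forall cx, cx \in s -> A cx.2) /\ v = \sum_(cx <- s) cx.1 *: cx.2 >].

Lemma span_closed (F : fieldType) (V : lmodType F) (A : V -> Prop) :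
  submod_closed (span_pred A).
Proof.
split=> [|a x y /asboolP[s [As ->]] /asboolP[t [At ->]]]; apply/asboolP.
  by exists [::]; split=> //; rewrite big_nil.
exists ([seq (a * cx.1, cx.2) | cx <- s] ++ t); split=> [cx|].
  by rewrite mem_cat => /orP[/mapP[cx' /As ? ->] | /At].
rewrite big_cat big_map scaler_sumr; congr (_ + _).
by apply: eq_bigr => cx _; rewrite scalerA.
Qed.

Section Span.

Variables (F : fieldType) (gT : finGroupType) (M : repType F gT).
Variable A : M -> Prop.
Hypothesis A_stable : forall x g, A x -> A (rep_act M x g).

Lemma span_stable x g : x \in span_pred A -> rep_act M x g \in span_pred A.
Proof.
case/asboolP=> s [As ->]; apply/asboolP.
exists [seq (cx.1, rep_act M cx.2 g) | cx <- s]; split=> [cx|].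
  by case/mapP=> cx' /As Acx' ->; apply: A_stable.
rewrite big_map; elim: s {As} => [|cx s IHs].
  by rewrite !big_nil rep_act0.
by rewrite !big_cons rep_act_linear IHs.
Qed.

Definition span_subrep : subrep M := mk_subrep (span_closed A) span_stable.

End Span.

Section Coinvariant.

Variable n : nat.

Local Notation P := {mpoly rat[n]}.

Definition poly_act (p : P) (s : 'S_n) : P := msym s p.

Lemma poly_actX i s : poly_act 'X_i s = 'X_(s i).
Proof.
rewrite /poly_act msymX; congr 'X_[_]; apply/mnmP=> j.
by rewrite mnmE !mnm1E -(inj_eq (@perm_inj _ s)) permKV.
Qed.

Lemma poly_act1 : poly_act^~ 1%g =1 id.
Proof. exact: msym1m. Qed.

Lemma poly_actM p : act_morph poly_act p.
Proof. by move=> s t; apply: msymMm. Qed.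

Lemma poly_act_linear s : linear (TotalAction poly_act1 poly_actM ^~ s).
Proof. by move=> a p q; rewrite /= /poly_act linearP. Qed.

Definition poly_rep : repType rat 'S_n := RepType poly_act_linear.

Definition sym_ideal_pred : {pred P} :=
  fun p => `[< exists s : seq (P * P),
    (forall cf, cf \in s -> cf.2 \is symmetric /\ cf.2@_0%MM = 0) /\
    p = \sum_(cf <- s) cf.1 * cf.2 >].

Lemma sym_ideal_idealr : idealr_closed sym_ideal_pred.
Proof.
split=> [||c p q /asboolP[s [As ->]] /asboolP[t [At ->]]].
- by apply/asboolP; exists [::]; split=> //; rewrite big_nil.
- apply/asboolP=> -[s [As]] /(congr1 (mcoeff 0%MM)); apply/eqP.
  rewrite mcoeff1 eqxx raddf_sum big_seq big1 ?oner_eq0 //= => cf /As[_ cf0].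
  by rewrite rmorphM /= cf0 mulr0.
apply/asboolP; exists ([seq (c * cf.1, cf.2) | cf <- s] ++ t); split=> [cf|].
  by rewrite mem_cat => /orP[/mapP[cf' /As ? ->] | /At].
rewrite big_cat big_map mulr_sumr; congr (_ + _).
by apply: eq_bigr => cf _; rewrite mulrA.
Qed.

HB.instance Definition _ := isIdealr.Build P sym_ideal_pred sym_ideal_idealr.

Lemma sym_ideal_scale a p : p \in sym_ideal_pred -> a *: p \in sym_ideal_pred.
Proof. by rewrite -mul_mpolyC => Ip; apply: idealMr. Qed.

Lemma sym_ideal_stable (p : poly_rep) s :
  p \in sym_ideal_pred -> rep_act poly_rep p s \in sym_ideal_pred.
Proof.
case/asboolP=> t [At ->]; apply/asboolP.
exists [seq (msym s cf.1, cf.2) | cf <- t]; split=> [cf|].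
  by case/mapP=> cf' /At ? ->.
rewrite big_map /= /poly_act rmorph_sum big_seq [RHS]big_seq /=.
by apply: eq_bigr => cf /At[/issymP sym_f _]; rewrite rmorphM /= sym_f.
Qed.

Definition sym_ideal : subrep poly_rep :=
  @SubRep _ _ poly_rep sym_ideal_pred sym_ideal_scale sym_ideal_stable.

Definition coinv : repType rat 'S_n := quot_rep sym_ideal.

Definition psi : rep_hom poly_rep coinv := quot_proj sym_ideal.

Lemma coinvE : rep_sort coinv = {ideal_quot sym_ideal_pred} :> Type.
Proof. by []. Qed.

Lemma homog_stable k (p : poly_rep) s :
  p \is k.-homog -> rep_act poly_rep p s \is k.-homog.
Proof.
move=> /dhomogP hp; apply/dhomogP=> m; rewrite /= /poly_act.
by rewrite mcoeff_msupp mcoeff_sym -mcoeff_msupp => /hp /= <-; apply/esym/mdeg_mperm.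
Qed.

Definition homog_subrep k : subrep poly_rep :=
  @mk_subrep _ _ poly_rep (mem (k.-homog : qualifier _ P))
    (dhomog_submod_closed _ _ k) (@homog_stable k).

Definition coinv_homog k : repType rat 'S_n :=
  sub_rep (im_subrep psi (homog_subrep k)).

(* Partitions with at most n parts, padded with zeroes to length n. *)
Record part := Part {
  part_val :> n.-tuple nat;
  part_valP : sorted geq part_val
}.

HB.instance Definition _ := [isSub for part_val].
HB.instance Definition _ := [Equality of part by <:].

Lemma exp_part_subproof (m : 'X_{1..n}) : sorted geq (sort_tuple geq m).
Proof. by apply: sort_sorted => i j; apply: leq_total. Qed.

Definition exp_part (m : 'X_{1..n}) : part := Part (exp_part_subproof m).

Lemma exp_part_perm (m : 'X_{1..n}) (s : 'S_n) :
  exp_part [multinom m (s i) | i < n] = exp_part m.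
Proof.
apply/val_inj/val_inj/perm_sortP => /=.
- by move=> i j; apply: leq_total.
- by move=> j i k ij jk; apply: leq_trans jk ij.
- by move=> i j; rewrite andbC => /anti_leq.
by apply/tuple_permP; exists s.
Qed.

(* Only partitions of the same number are comparable. *)
Definition dominated (mu la : part) : bool :=
  (sumn mu == sumn la) &&
  [forall k : 'I_n.+1, (sumn (take k mu) <= sumn (take k la))%N].

Definition strictly_dominated (mu la : part) : bool :=
  (mu != la) && dominated mu la.

Definition monom_set (D : pred part) (p : poly_rep) : Prop :=
  exists2 m : 'X_{1..n}, D (exp_part m) & p = 'X_[m].

Lemma monom_set_stable D p s :
  monom_set D p -> monom_set D (rep_act poly_rep p s).
Proof.
case=> m Dm ->; exists [multinom m (s^-1 i)%g | i < n]; first by rewrite exp_part_perm.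
by rewrite /= /poly_act msymX.
Qed.

Definition monom_span (D : pred part) : subrep poly_rep :=
  span_subrep (@monom_set_stable D).

Definition Pdom (la : part) := monom_span (dominated^~ la).
Definition Psdom (la : part) := monom_span (strictly_dominated^~ la).

Lemma im_Psdom_sub la :
  {subset im_subrep psi (Psdom la) <= im_subrep psi (Pdom la)}.
Proof.
move=> y /asboolP[p /asboolP[s [sP ->]] ->]; apply/asboolP.
eexists; last by []; apply/asboolP; exists s; split=> // cx /sP[m].
by case/andP=> _ ? ->; exists m.
Qed.

Definition Rpart (la : part) : repType rat 'S_n :=
  subquot_rep (im_subrep psi (Pdom la)) (im_subrep psi (Psdom la)).

(* A subset of [n] is given as S : {set 'I_n}, with i : 'I_n standing for i + 1,
   so that the i-th component below is lambda_(i + 1). *)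
Definition subset_tuple (S : {set 'I_n}) : n.-tuple nat :=
  [tuple #|S :&: [set j : 'I_n | (i <= j)%N]| | i < n].

Lemma subset_part_subproof S : sorted geq (subset_tuple S).
Proof.
rewrite sorted_map; apply: (@sub_sorted _ (relpre val ltn)) => [i j /= ij|].
  apply/subset_leq_card/setIS/subsetP=> k; rewrite !inE; exact/leq_trans/ltnW.
by rewrite -sorted_map val_enum_ord iota_ltn_sorted.
Qed.

Definition subset_part (S : {set 'I_n}) : part := Part (subset_part_subproof S).

(* The subsets of [n - 1], among those of [n], whose elements sum to k. *)
Definition subsets_of_sum (k : nat) : {set {set 'I_n}} :=
  [set S : {set 'I_n} | [forall i in S, (i.+1 <= n.-1)%N] &&
                        (\sum_(i in S) i.+1 == k)%N].

End Coinvariant.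

(* Main.v *)
Require Import Defs.
From HB Require Import structures.
From mathcomp Require Import all_boot all_order all_fingroup all_algebra.
From mathcomp Require Import mpoly boolp generic_quotient ring_quotient.
From mathcomp Require Import zify.

(** Order the indices of a monomial [m] by decreasing exponent, ties being broken
    by the index, and let [raise r m] multiply [m] by its first [r] variables.
    Multiplying ['X_[m]] by the elementary symmetric polynomial [e_r] yields
    ['X_[raise r m]] plus monomials that are lower: strictly dominated, or with
    the same exponent partition but more inversions.  Hence the products
    [garsia m] of elementary symmetric polynomials with a descent monomial
    (Garsia and Stanton) form a basis of the polynomial ring that is unitriangular
    over the monomials.  As [e_r * garsia m = garsia (raise r m)], the ideal [I_n]
    is spanned by the [garsia m] with a nontrivial symmetric factor, so that the
    remaining descent monomials (those with [good m]) are a basis of the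
    coinvariant algebra adapted to every [psi (Pdom la)] at once; their exponent
    partitions are the [subset_part S].  The linear projections onto the [Rpart la]
    read off this basis become equivariant after averaging over ['S_n], still
    vanish on [psi (Pdom mu)] unless [la] is dominated by [mu], and are canonical
    on [psi (Pdom la)]; by triangularity they are jointly bijective. *)

Set Implicit Arguments.
Unset Strict Implicit.
Unset Printing Implicit Defensive.

Import GRing.Theory.

(** * Monomials and their descent decomposition *)

Section Order.
Variable n : nat.
Implicit Types (m : 'X_{1..n}) (i k : 'I_n) (r : nat) (U V : {set 'I_n}).

Definition before m i k := (m k < m i) || ((m k == m i) && (i < k)).

Lemma before_irr m i : before m i i = false.
Proof. by rewrite /before !ltnn andbF. Qed.

Lemma before_trans m : transitive (before m).
Proof.
move=> k i l; rewrite /before => /orP[ki|/andP[/eqP ki ik]].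
  case/orP=> [lk|/andP[/eqP-> _]]; last by rewrite ki.
  by rewrite (ltn_trans lk ki).
case/orP=> [lk|/andP[/eqP lk kl]]; first by rewrite -ki lk.
by rewrite lk ki eqxx (ltn_trans ik kl) orbT.
Qed.

Lemma before_total m i k : i != k -> before m i k || before m k i.
Proof.
rewrite /before; case: (ltngtP (m k) (m i)) => //= _.
by rewrite -val_eqE; case: ltngtP.
Qed.

Lemma before_asym m i k : before m i k -> before m k i = false.
Proof. by move=> ik; apply/negP => /(before_trans ik); rewrite before_irr. Qed.

(** Both relations are strict total orders on the indices, so one inclusion gives equality. *)
Lemma before_ext m m' : (forall i k, before m i k -> before m' i k) ->
  before m' =2 before m.
Proof.
move=> mono i k; apply/idP/idP=> [ik|/mono//].
case: (eqVneq i k) ik => [->|/(before_total m)/orP[//|/mono/before_asym->//]].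
by rewrite before_irr.
Qed.

Definition rank m i := #|[set k | before m k i]|.

Lemma rank_mono m i k : before m i k -> rank m i < rank m k.
Proof.
move=> ik; apply/proper_card/properP; split.
  by apply/subsetP=> l; rewrite !inE => /before_trans; apply.
by exists i; rewrite !inE ?before_irr.
Qed.

Lemma rank_ltP m i k : (rank m i < rank m k) = before m i k.
Proof.
apply/idP/idP; last exact: rank_mono.
case: (eqVneq i k) => [->|/(before_total m)/orP[//|/rank_mono ki]].
  by rewrite ltnn.
by rewrite ltnNge ltnW.
Qed.

Lemma rank_le m i k : rank m i <= rank m k -> m k < m i \/ m k = m i /\ i <= k.
Proof.
rewrite leqNgt rank_ltP; case: (eqVneq i k) => [->|/(before_total m)]; first by right.
by case/orP=> [ik _|-> //]; move: ik; rewrite /before; lia.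
Qed.

Lemma rank_inj m : injective (rank m).
Proof.
move=> i k e; apply/eqP/negPn/negP => /(before_total m).
by rewrite -!rank_ltP e ltnn.
Qed.

Lemma rank_lt m i : rank m i < n.
Proof.
rewrite -[X in _ < X]card_ord -cardsT; apply/proper_card/properP.
by split=> //; exists i; rewrite ?inE ?before_irr.
Qed.

Lemma rank_perm_subproof m : injective (fun i => Ordinal (rank_lt m i)).
Proof. by move=> i k [] /rank_inj. Qed.

Definition rank_perm m : 'S_n := perm (@rank_perm_subproof m).

Lemma rank_permE m i : rank_perm m i = rank m i :> nat.
Proof. by rewrite permE. Qed.

Lemma sum_rank m (F : nat -> nat) : \sum_i F (rank m i) = \sum_(j < n) F j.
Proof.
rewrite [RHS](reindex_inj (@perm_inj _ (rank_perm m))) /=.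
by apply: eq_bigr => i _; rewrite rank_permE.
Qed.

Definition top m r := [set i | rank m i < r].

Lemma card_top m r : #|top m r| = minn r n.
Proof.
rewrite -sum1_card (eq_bigl (fun i => rank m i < r)); last by move=> i; rewrite inE.
rewrite big_mkcond (sum_rank m (fun j => if j < r then 1 else 0)) /=.
elim: (n) => [|p IHp]; first by rewrite big_ord0 minn0.
by rewrite big_ord_recr /= IHp; case: ifP; lia.
Qed.

Lemma topP m r i k : i \in top m r -> k \notin top m r -> before m i k.
Proof. by rewrite !inE -leqNgt -rank_ltP; apply: leq_trans. Qed.

Lemma top_le m r i k : i \in top m r -> k \notin top m r -> m k <= m i.
Proof. by move=> /topP h /h /orP[/ltnW|/andP[/eqP->]]. Qed.

Lemma rankE m m' : before m =2 before m' -> rank m =1 rank m'.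
Proof. by move=> e i; apply: eq_card => k; rewrite !inE e. Qed.

Lemma topE m m' : before m =2 before m' -> top m =1 top m'.
Proof. by move=> /rankE e r; apply/setP => k; rewrite !inE e. Qed.

(** * Sums of the largest exponents *)

Definition head_sum m r := \sum_(i in top m r) m i.

(* Cutting all exponents at height [v], the smallest exponent in [top m r]:
   [m i <= v + (m i - v)], with equality on [top m r]. *)
Lemma sum_le_head m r U : #|U| = #|top m r| -> \sum_(i in U) m i <= head_sum m r.
Proof.
move=> cU.
have: exists v, (forall i, i \in top m r -> v <= m i) /\
                (forall i, i \notin top m r -> m i <= v).
  have [e|[i0 i0T]] := set_0Vmem (top m r).
    (* With an empty head, [v] only has to bound all exponents. *)
    exists (\max_i m i); split=> i; rewrite ?e ?inE //.
    by move=> _; apply: leq_bigmax.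
  case: (@arg_minnP _ i0 (mem (top m r)) m i0T) => i iT imin.
  by exists (m i); split=> k kT; [apply: imin | apply: top_le iT kT].
case=> v [vT vNT]; apply: (@leq_trans (#|U| * v + \sum_i (m i - v))).
  rewrite -sum_nat_const.
  apply: (@leq_trans (\sum_(i in U) v + \sum_(i in U) (m i - v))).
    by rewrite -big_split; apply: leq_sum => i _ /=; lia.
  by rewrite leq_add2l [leqRHS](bigID (mem U)) leq_addr.
rewrite cU -sum_nat_const (bigID (mem (top m r)) predT) /=.
rewrite [X in _ + (_ + X)]big1 => [|i /vNT]; last by lia.
by rewrite addn0 -big_split /=; apply: leq_sum => i /vT; lia.
Qed.

(** Exchange argument: replacing [i] by [k] keeps the size of [U], so it cannot increase a sum that
    is already maximal. *)
Lemma eq_head_sum m r U i k : #|U| = #|top m r| ->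
  \sum_(l in U) m l = head_sum m r -> i \in U -> k \notin U -> m k <= m i.
Proof.
move=> cU eU iU kNU.
have kNU' : k \notin U :\ i by rewrite !inE (negbTE kNU) andbF.
have /sum_le_head : #|k |: U :\ i| = #|top m r|.
  by rewrite -cU cardsU1 kNU' (cardsD1 i U) iU.
rewrite -eU big_setU1 //= [leqRHS](big_setD1 i) //=. by rewrite leq_add2r.
Qed.

(** * Raising exponents, inversions and the order [lower] *)

Definition add_set m U : 'X_{1..n} := (m + mesym1 U)%MM.

Lemma add_setE m U i : add_set m U i = m i + (i \in U).
Proof. by rewrite /add_set mnmDE mnmE. Qed.

Definition raise r m := add_set m (top m r).

(** The exponents of an initial segment of the order grow together, so no comparison changes. Ranks
    and descents, being defined from [before], are therefore invariant under raising. *)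
Lemma raise_before m r : before (raise r m) =2 before m.
Proof.
apply: before_ext => i k ik; have := ik; rewrite /before !add_setE !inE.
by move: ik; rewrite -rank_ltP; do 2!case: ltnP; lia.
Qed.

Lemma card_topI m r s : #|top m r :&: top m s| = minn #|top m r| #|top m s|.
Proof.
have -> : top m r :&: top m s = top m (minn r s).
  by apply/setP=> i; rewrite !inE leq_min.
by rewrite !card_top; lia.
Qed.

Lemma sum_add_set m U V :
  \sum_(i in V) add_set m U i = \sum_(i in V) m i + #|V :&: U|.
Proof.
rewrite (eq_bigr _ (fun i _ => add_setE m U i)) big_split /=; congr (_ + _).
rewrite -sum1_card [LHS]big_mkcond [RHS]big_mkcond.
by apply: eq_bigr => i _; rewrite inE; do 2!case: (_ \in _).
Qed.

Lemma head_sum_raise m r s :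
  head_sum (raise r m) s = head_sum m s + minn #|top m s| #|top m r|.
Proof.
by rewrite /head_sum (topE (raise_before m r)) sum_add_set card_topI.
Qed.

(** These are the pairs that [before m] lists against the order of the indices; their number depends
    on [before m] alone. *)
Definition inv m := #|[set u : 'I_n * 'I_n | (u.1 < u.2) && (m u.1 < m u.2)]|.

Lemma inv_raise m r : inv (raise r m) = inv m.
Proof.
apply: eq_card => -[i k]; rewrite !inE /=; case: ltnP => //= ik.
have := raise_before m r k i; rewrite /before.
by rewrite ![k < i]ltnNge ![i <= k]ltnW //= !andbF !orbF.
Qed.

(** The second clause is dominance of exponent partitions. The third makes the relation strict;
    stated as an implication, it survives composition and raising. *)
Definition lower m' m := [/\ mdeg m' = mdeg m,
  forall r, head_sum m' r <= head_sum m r &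
  (forall r, head_sum m' r = head_sum m r) -> inv m < inv m'].

Lemma lower_trans m1 m2 m3 : lower m1 m2 -> lower m2 m3 -> lower m1 m3.
Proof.
case=> d12 h12 e12 [d23 h23 e23]; split=> [|r|e]; first by rewrite d12.
  exact: leq_trans (h12 r) (h23 r).
have e' r : head_sum m1 r = head_sum m2 r.
  by apply/eqP; rewrite eqn_leq h12 e h23.
by apply: ltn_trans (e12 e'); apply: e23 => r; rewrite -e' e.
Qed.

Lemma lower_raise r m m' : lower m' m -> lower (raise r m') (raise r m).
Proof.
case=> d h e; split=> [|s|e'].
- by rewrite !mdegD !mdeg_mesym1 !card_top d.
- by rewrite !head_sum_raise !card_top leq_add2r.
rewrite !inv_raise; apply: e => s; have := e' s.
by rewrite !head_sum_raise !card_top => /addIn.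
Qed.

(* Ties between exponents are broken by the index, so that choosing any other
   set of largest exponents creates an inversion. *)
Lemma lower_add_set m r U : #|U| = #|top m r| -> U != top m r ->
  lower (add_set m U) (raise r m).
Proof.
move=> cU neU.
have le s V : #|V| = #|top m s| ->
    \sum_(i in V) add_set m U i <= head_sum (raise r m) s.
  move=> cV; rewrite head_sum_raise sum_add_set leq_add ?sum_le_head //.
  rewrite leq_min -cV -cU.
  by rewrite !subset_leq_card ?subsetIl ?subsetIr.
split=> [|s|e]; first by rewrite !mdegD !mdeg_mesym1 cU.
  by apply: le; rewrite !card_top.
set V := top (add_set m U) r.
have cV : #|V| = #|top m r| by rewrite !card_top.
have := e r; rewrite head_sum_raise /head_sum sum_add_set -/V minnn => eV.
have leV := sum_le_head cV; have leI := subset_leq_card (subsetIl V U).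
have [eS eI] : \sum_(i in V) m i = head_sum m r /\ #|V :&: U| = #|V|.
  have split4 a b c d : a <= c -> b <= d -> a + b = c + d -> a = c /\ b = d by lia.
  by apply: split4 leV leI _; rewrite eV cV.
have eVU : V = U.
  apply/eqP; rewrite eqEcard cV cU leqnn andbT.
  by apply/setIidPl/eqP; rewrite eqEcard subsetIl eI leqnn.
have upU i k : i \in U -> k \notin U -> m k <= m i.
  by apply: eq_head_sum cU _; rewrite -eVU.
have /subsetPn[k kU kNT] : ~~ (U \subset top m r).
  by apply: contra neU => sU; rewrite eqEcard sU cU leqnn.
have /subsetPn[i iT iNU] : ~~ (top m r \subset U).
  by apply: contra neU => sT; rewrite eq_sym eqEcard sT cU leqnn.
(* Inversions of [m] survive, since its exponents in [U] are at least those outside. The pair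
   [(i, k)] is a new one: a tie of [m] in which only [k] is raised. *)
rewrite inv_raise; apply/proper_card/properP; split.
  apply/subsetP=> -[i' k']; rewrite !inE /= !add_setE => /andP[-> lt'].
  by have := upU i' k'; case: (i' \in U); case: (k' \in U) => //= h; lia.
exists (i, k); rewrite !inE /=.
  rewrite !add_setE kU (negbTE iNU).
  by have := topP iT kNT; have := upU _ _ kU iNU; rewrite /before; lia.
by have := top_le iT kNT; lia.
Qed.

(* Junk value [0] for [n <= j], so that [gap m n.-1] is the smallest exponent. *)
Definition lam m j := \sum_(i | rank m i == j) m i.

Lemma lam_rank m i : lam m (rank m i) = m i.
Proof. by apply: big_pred1 => k /=; rewrite (inj_eq (@rank_inj m)). Qed.

Lemma rank_onto m j : j < n -> exists i, rank m i = j.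
Proof.
by move=> jn; exists ((rank_perm m)^-1%g (Ordinal jn)); rewrite -rank_permE permKV.
Qed.

Lemma lam_out m j : n <= j -> lam m j = 0.
Proof.
move=> le_nj; apply: big1 => i /eqP e.
by have := rank_lt m i; rewrite e ltnNge le_nj.
Qed.

Lemma head_sumE m r : head_sum m r = \sum_(j < r) lam m j.
Proof.
elim: r => [|r IHr].
  by rewrite big_ord0 /head_sum big1 // => i; rewrite inE.
rewrite big_ord_recr -IHr /head_sum /lam /= (bigID [pred i | rank m i == r]) /= addnC.
by congr (_ + _); apply: eq_bigl => i; rewrite !inE; lia.
Qed.

Lemma lam_decr m j : lam m j.+1 <= lam m j.
Proof.
case: (ltnP j.+1 n) => [lt_jn|/lam_out-> //].
have [k kE] := rank_onto m lt_jn.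
have [i iE] := rank_onto m (ltnW lt_jn).
rewrite -kE -iE !lam_rank.
have : before m i k by rewrite -rank_ltP iE kE /=.
by case/orP=> [/ltnW|/andP[/eqP->]].
Qed.

Lemma lam_raise m r j : r <= n -> lam (raise r m) j = lam m j + (j < r).
Proof.
move=> le_rn; case: (ltnP j n) => [lt_jn|le_nj]; last by rewrite !lam_out //; lia.
have [i <-] := rank_onto m lt_jn.
rewrite lam_rank -{1}(rankE (raise_before m r)).
by rewrite lam_rank add_setE inE.
Qed.

(** * Gaps, descents and the excess *)

Definition gap m j := lam m j - lam m j.+1.

(** Telescoping sum, ending at [lam m n = 0]. *)
Lemma sum_gap m i : \sum_(j < n | rank m i <= j) gap m j = m i.
Proof.
suff tele d a : a + d = n -> \sum_(j < n | a <= j) gap m j = lam m a.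
  by rewrite (tele (n - rank m i)) ?lam_rank // subnKC // ltnW ?rank_lt.
elim: d a => [|d IHd] a aE.
  rewrite big1 ?lam_out //; first by rewrite -aE addn0.
  by move=> j; have := ltn_ord j; lia.
have lt_an : a < n by lia.
rewrite (bigD1 (Ordinal lt_an)) //= (eq_bigl (fun j : 'I_n => a.+1 <= j)).
  by rewrite IHd ?subnK ?lam_decr //; lia.
by move=> j; rewrite -val_eqE /=; lia.
Qed.

(** Descents, counted from position 0, of the word listing the indices in the order [before m].
    There is none at [n.-1], as no index has rank [n]. *)
Definition desc m j :=
  [exists i, exists k, [&& rank m i == j, rank m k == j.+1 & k < i]].

(** Ties are broken by increasing index, so a descent is never a tie: the exponent drops there. *)
Lemma desc_gap m j : desc m j <= gap m j.
Proof.
case: (boolP (desc m j)) => // /existsP[i /existsP[k /and3P[/eqP ij /eqP kj ki]]].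
rewrite /gap -ij lam_rank ij -kj lam_rank subn_gt0.
have : before m i k by rewrite -rank_ltP ij kj.
by rewrite /before; lia.
Qed.

Lemma descE m m' : before m =2 before m' -> desc m =1 desc m'.
Proof.
by move=> /rankE e j; apply: eq_existsb => i; apply: eq_existsb => k; rewrite !e.
Qed.

(** The subtraction is exact by [desc_gap]. *)
Definition excess m j := gap m j - desc m j.

(** Raising the first [j.+1] positions widens the gap at [j] only and keeps the descents. *)
Lemma excess_raise m (j : 'I_n) i : excess (raise j.+1 m) i = excess m i + (i == j).
Proof.
rewrite /excess (descE (raise_before m j.+1)) -val_eqE /=.
have := desc_gap m i; have := lam_decr m i.
by rewrite /gap !lam_raise //; lia.
Qed.

(** The descent monomial: the product, over the descents [j], of the first [j.+1] variables in the
    order [before m]. *)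
Definition base m : 'X_{1..n} :=
  [multinom \sum_(j < n | rank m i <= j) desc m j | i < n].

Lemma base_raise m r : base (raise r m) = base m.
Proof.
apply/mnmP => i; rewrite !mnmE (rankE (raise_before m r)).
by apply: eq_bigr => j _; rewrite (descE (raise_before m r)).
Qed.

Definition good m := [forall j : 'I_n, excess m j == 0].

Lemma goodP m : reflect (forall j : 'I_n, gap m j = desc m j) (good m).
Proof.
apply: (iffP forallP) => h j; have := h j; rewrite subn_eq0.
  by move=> le; apply/eqP; rewrite eqn_leq le desc_gap.
by move->.
Qed.

Lemma good_base m : good m -> base m = m.
Proof.
move=> /goodP gm; apply/mnmP=> i; rewrite mnmE -[RHS]sum_gap.
by apply: eq_bigr.
Qed.

Lemma good_raise m (j : 'I_n) : ~~ good (raise j.+1 m).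
Proof. by apply/forallPn; exists j; rewrite excess_raise eqxx addn1. Qed.

(** An excess at [j] leaves room to lower the first [j.+1] exponents by one without disturbing the
    order; this undoes a raise. *)
Lemma not_goodP m : ~~ good m -> exists (j : 'I_n) m', m = raise j.+1 m'.
Proof.
case/forallPn=> j xj; exists j.
(* Positivity makes the truncated subtraction in [m'] exact. *)
have pos i : i \in top m j.+1 -> 0 < m i.
  rewrite inE => ij; have := desc_gap m j; have : gap m j <= m i; last first.
    by rewrite /excess in xj; lia.
  by rewrite -(sum_gap m i) (bigD1 j) //= leq_addr.
pose m' : 'X_{1..n} := [multinom m i - (i \in top m j.+1) | i < n].
have m'E : before m' =2 before m.
  apply: before_ext => i k ik; rewrite /before !mnmE.
  have := pos i; case: (boolP (i \in _)) => iT; last first.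
    have kNT : k \notin top m j.+1.
      by apply: contra iT; rewrite !inE; move: ik; rewrite -rank_ltP; lia.
    by rewrite (negbTE kNT) !subn0.
  move=> /(_ isT) mi; have := pos k; case: (boolP (k \in _)) => kT.
    by move=> /(_ isT); move: ik; rewrite /before; lia.
  (* The critical case: only [i] is lowered. The pair is compared through [i0] and [k0], at
     positions [j] and [j.+1]: if lowering creates a tie, then the gap is one, there is no descent,
     and the indices settle the tie in favour of [i]. *)
  move=> _; move: iT kT; rewrite !inE -leqNgt ltnS => ij jk.
  have [k0 k0E] := rank_onto m (leq_ltn_trans jk (rank_lt m k)).
  have [i0 i0E] := rank_onto m (ltn_ord j).
  move: xj; rewrite /excess /gap -i0E lam_rank i0E -k0E lam_rank.
  rewrite -i0E in ij; rewrite -k0E in jk.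
  have : desc m j = (k0 < i0).
    apply/existsP/idP=> [[i1 /existsP[k1 /and3P[/eqP i1E /eqP k1E]]]|ki].
      rewrite -i0E in i1E; rewrite -k0E in k1E.
      by rewrite (rank_inj i1E) (rank_inj k1E).
    by exists i0; apply/existsP; exists k0; rewrite i0E k0E !eqxx.
  have : i != k by apply: contraTneq ik => ->; rewrite before_irr.
  by rewrite -val_eqE /=; have := rank_le ij; have := rank_le jk; lia.
exists m'; apply/mnmP=> i; rewrite add_setE (topE m'E) mnmE.
by have := pos i; case: (i \in _); lia.
Qed.

Local Notation e j := (mesym n rat j).

Definition garsia m : {mpoly rat[n]} :=
  (\prod_(j < n) e j.+1 ^+ excess m j * 'X_[base m])%R.

Lemma garsia_raise m (j : 'I_n) : (e j.+1 * garsia m = garsia (raise j.+1 m))%R.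
Proof.
rewrite /garsia base_raise mulrA; congr (_ * _)%R.
rewrite [in RHS](eq_bigr (fun i : 'I_n =>
  e i.+1 ^+ excess m i * (if i == j then e j.+1 else 1)))%R.
  by rewrite big_split /= -big_mkcond big_pred1_eq mulrC.
move=> i _; rewrite excess_raise; case: eqVneq => [->|_].
  by rewrite addn1 exprSr.
by rewrite addn0 mulr1.
Qed.

Lemma garsia_good m : good m -> garsia m = 'X_[m].
Proof.
move=> gm; rewrite /garsia good_base // big1 ?mul1r // => j _.
by have /forallP/(_ j)/eqP-> := gm; rewrite expr0.
Qed.

(** Undoing a raise decreases the degree, so every monomial comes from a good one by raises. *)
Lemma good_ind (Q : 'X_{1..n} -> Prop) :
  (forall m, good m -> Q m) ->
  (forall m (j : 'I_n), Q m -> Q (raise j.+1 m)) -> forall m, Q m.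
Proof.
move=> Qgood Qraise m; have [d] := ubnP (mdeg m).
elim: d m => // d IHd m lt_md.
have [/Qgood//|/not_goodP[j [m' mE]]] := boolP (good m).
rewrite mE; apply/Qraise/IHd; move: lt_md.
rewrite mE mdegD mdeg_mesym1 card_top.
by have := ltn_ord j; lia.
Qed.


(** * Exponent partitions and dominance *)

Lemma head_sum_mdeg m r : n <= r -> head_sum m r = mdeg m.
Proof.
move=> le_nr; rewrite /head_sum mdegE; apply: eq_bigl => i.
by rewrite inE (leq_trans (rank_lt m i)).
Qed.

Lemma exp_partE m : exp_part m = mkseq (lam m) n :> seq nat.
Proof.
apply: (@sorted_eq _ geq).
- by move=> j i k ij jk; apply: leq_trans jk ij.
- by move=> i j; rewrite andbC => /anti_leq.
- exact: part_valP.
- apply/(sortedP 0) => j; rewrite size_mkseq => jn.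
  by rewrite !nth_mkseq ?(ltnW jn) //; apply: lam_decr.
rewrite /= perm_sort.
have -> : mkseq (lam m) n = [tuple lam m j | j < n].
  by rewrite /mkseq -val_enum_ord -map_comp.
apply/tuple_permP; exists (rank_perm m); congr (tval _); apply: eq_from_tnth => i.
by rewrite !tnth_mktuple rank_permE lam_rank.
Qed.

Lemma sumn_take_exp_part m r : sumn (take r (exp_part m)) = head_sum m r.
Proof.
have le r' : r' <= n -> sumn (take r' (exp_part m)) = head_sum m r'.
  move=> le_rn; rewrite exp_partE -map_take take_iota (minn_idPl le_rn).
  by rewrite sumnE big_map -[X in iota 0 X]subn0 big_mkord head_sumE.
case: (leqP r n) => [/le//|/ltnW le_nr].
rewrite take_oversize ?size_tuple // head_sum_mdeg //.
rewrite -(head_sum_mdeg m (leqnn n)) -le //.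
by rewrite take_oversize // size_tuple.
Qed.

Lemma sumn_exp_part m : sumn (exp_part m) = mdeg m.
Proof.
by rewrite -(head_sum_mdeg m (leqnn n)) -sumn_take_exp_part take_oversize ?size_tuple.
Qed.

Lemma dominated_refl (la : part n) : dominated la la.
Proof. by rewrite /dominated eqxx; apply/forallP. Qed.

Lemma dominated_trans (la mu nu : part n) :
  dominated la mu -> dominated mu nu -> dominated la nu.
Proof.
move=> /andP[/eqP slm /forallP lm] /andP[/eqP smn /forallP mn].
rewrite /dominated slm smn eqxx; apply/forallP=> k; exact: leq_trans (lm k) (mn k).
Qed.

(** A number strictly monotone for dominance; it supplies induction measures and antisymmetry. *)
Definition height (la : part n) := \sum_(k < n.+1) sumn (take k la).

(** If the totals agree, then so do all partial sums, and hence their differences, the parts. *)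
Lemma dominated_height (la mu : part n) :
  dominated la mu -> height la <= height mu ?= iff (la == mu).
Proof.
move=> /andP[_ /forallP lm].
have [le eqE] := leqif_sum (P := predT) (fun l _ => leqif_eq (lm l)).
split=> //; rewrite eqE; apply/forallP/eqP => [eq|-> l]; last by rewrite eqxx.
apply/val_inj/val_inj/(@eq_from_nth _ 0); rewrite ?size_tuple // => i ltin.
have take_nth (s : n.-tuple nat) :
    sumn (take i.+1 s) = sumn (take i s) + nth 0 s i.
  by rewrite (take_nth 0) ?size_tuple // sumn_rcons.
have := eqP (eq (Ordinal (ltin : i.+1 < n.+1))) => /=.
have := eqP (eq (Ordinal (ltnW ltin : i < n.+1))) => /=.
by rewrite !take_nth => -> /addnI.
Qed.

Lemma lower_dominated m m' : lower m' m -> dominated (exp_part m') (exp_part m).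
Proof.
case=> d h _; rewrite /dominated !sumn_exp_part d eqxx.
by apply/forallP=> k; rewrite !sumn_take_exp_part.
Qed.

(** Lexicographic order on [height] and reversed [inv], encoded as one number thanks to
    [inv m <= n * n]. *)
Definition lower_measure m := height (exp_part m) * (n * n).+1 + (n * n - inv m).

Lemma lower_measure_lt m m' : lower m' m -> lower_measure m' < lower_measure m.
Proof.
move=> low; have [le eqE] := dominated_height (lower_dominated low).
have le_inv m1 : inv m1 <= n * n.
  by rewrite (leq_trans (max_card _)) // card_prod card_ord.
have := le_inv m; have := le_inv m'; rewrite /lower_measure.
case: (ltngtP (height (exp_part m')) (height (exp_part m))) le eqE => // [lt|e] _ eqE.
  by nia.
have : inv m < inv m'.
  case: low => _ _; apply=> r; rewrite -!sumn_take_exp_part.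
  by rewrite (eqP (esym eqE : exp_part m' == exp_part m)).
by rewrite e; nia.
Qed.

Lemma tnth_exp_part m i : nth 0 (exp_part m) (rank m i) = m i.
Proof. by rewrite exp_partE nth_mkseq ?lam_rank ?rank_lt. Qed.

(** * Partitions attached to subsets *)

Implicit Types S : {set 'I_n}.

Lemma nth_subset_part S (i : nat) : i < n ->
  nth 0 (subset_part S) i = \sum_(j in S) (i <= j).
Proof.
move=> lt_in.
have -> : nth 0 (subset_part S) i = tnth (subset_tuple S) (Ordinal lt_in).
  by rewrite (tnth_nth 0).
rewrite tnth_mktuple.
rewrite -sum1_card big_mkcond [RHS]big_mkcond; apply: eq_bigr => j _.
by rewrite !inE; case: (j \in S) => //=; case: leqP.
Qed.

Lemma sumn_subset_part S : sumn (subset_part S) = \sum_(j in S) j.+1.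
Proof.
rewrite sumnE (big_nth 0) size_tuple big_mkord.
rewrite (eq_bigr _ (fun i _ => nth_subset_part S (ltn_ord i))) exchange_big /=.
apply: eq_bigr => j _; rewrite -[RHS]card_ord -sum1_card.
rewrite (big_ord_widen n (fun=> 1)) // [RHS]big_mkcond.
by apply: eq_bigr => i _; rewrite ltnS; case: (_ <= _).
Qed.

(** Membership of [j] is the difference of the consecutive parts at [j] and [j.+1], the default [0]
    serving after the last part. *)
Lemma subset_part_inj : injective (@subset_part n).
Proof.
have step S (j : 'I_n) :
    nth 0 (subset_part S) j = (j \in S) + nth 0 (subset_part S) j.+1.
  have out : n <= j.+1 -> nth 0 (subset_part S) j.+1 = \sum_(k in S) (j < k).
    move=> le_nj; rewrite nth_default ?size_tuple // big1 // => k _.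
    by rewrite ltnNge -ltnS (leq_trans (ltn_ord k)).
  have -> : nth 0 (subset_part S) j.+1 = \sum_(k in S) (j < k).
    by case: (ltnP j.+1 n) => [lt_jn|/out->//]; apply: nth_subset_part.
  rewrite nth_subset_part // (eq_bigr (fun k : 'I_n => (k == j) + (j < k))); last first.
    move=> k _; rewrite leq_eqVlt eq_sym val_eqE.
    by case: eqVneq => // ->; rewrite ltnn.
  rewrite big_split; congr (_ + _).
  case: (boolP (j \in S)) => jS.
    by rewrite (bigD1 j) //= eqxx big1 // => k /andP[_ /negbTE->].
  rewrite big1 // => k kS; case: eqVneq => // kj; by rewrite -kj kS in jS.
move=> S S' eqS; apply/setP=> j; have := step S' j; rewrite -eqS step => /addIn.
by do 2!case: (_ \in _).
Qed.

(** All gaps being [0] or [1], the partition is that of the descent set, which avoids the last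
    position. *)
Lemma good_exp_part m : good m ->
  exists2 S : {set 'I_n}, (forall i, i \in S -> i.+1 <= n.-1) &
    exp_part m = subset_part S.
Proof.
move=> /goodP gm; exists [set j : 'I_n | desc m j].
  move=> j; rewrite inE => /existsP[i /existsP[k /and3P[_ /eqP kE _]]].
  by have := rank_lt m k; rewrite kE; lia.
apply/val_inj/val_inj/(@eq_from_nth _ 0); rewrite !size_tuple // => i lt_in.
rewrite [RHS]nth_subset_part //; have [i' <-] := rank_onto m lt_in.
rewrite tnth_exp_part -sum_gap [LHS]big_mkcond [RHS]big_mkcond; apply: eq_bigr => j _.
by rewrite inE gm; case: (desc m j); case: leqP.
Qed.

End Order.

(** * The Garsia-Stanton basis *)

Section Polynomials.

Variable n : nat.
Local Open Scope ring_scope.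
Local Notation P := {mpoly rat[n]}.
Local Notation e j := (mesym n rat j).
Implicit Types (m : 'X_{1..n}) (p q : P) (A : 'X_{1..n} -> Prop).

Definition supported A p := forall m, m \in msupp p -> A m.

Lemma supported_ind A (Q : P -> Prop) :
  Q 0 -> (forall a p q, Q p -> Q q -> Q (a *: p + q)) ->
  (forall m, A m -> Q 'X_[m]) -> forall p, supported A p -> Q p.
Proof.
move=> Q0 Qlin QX p; rewrite [p in Q p]mpolyE /supported.
elim: (msupp p) => [|m s IHs] Am; first by rewrite big_nil.
rewrite big_cons; apply: Qlin; first by apply/QX/Am/mem_head.
by apply: IHs => m' m's; apply: Am; rewrite inE m's orbT.
Qed.

Lemma supported0 A : supported A 0.
Proof. by move=> m; rewrite msupp0. Qed.

Lemma supported_lin A a p q :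
  supported A p -> supported A q -> supported A (a *: p + q).
Proof.
move=> Ap Aq m; rewrite mcoeff_msupp mcoeffD mcoeffZ => nz.
case: (boolP (m \in msupp p)) => [/Ap//|/memN_msupp_eq0 p0].
by apply: Aq; rewrite mcoeff_msupp; rewrite p0 mulr0 add0r in nz.
Qed.

Lemma supportedX A m : A m -> supported A 'X_[m].
Proof. by move=> Am m'; rewrite msuppX inE => /eqP->. Qed.

Lemma supportedW A A' p : (forall m, A m -> A' m) -> supported A p -> supported A' p.
Proof. by move=> sub Ap m /Ap/sub. Qed.

Lemma supported_sum A (I : Type) (r : seq I) (Q : pred I) (F : I -> P) :
  (forall i, Q i -> supported A (F i)) -> supported A (\sum_(i <- r | Q i) F i).
Proof.
move=> AF; elim/big_ind: _ => //; first exact: supported0.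
by move=> p q Ap Aq; rewrite -[p]scale1r; apply: supported_lin.
Qed.

(** * Linear maps given on monomials *)

Section LinearExtension.

Variable F : 'X_{1..n} -> P.

Definition linext p := \sum_(m <- msupp p) p@_m *: F m.

Lemma linextE (s : seq 'X_{1..n}) p : uniq s -> {subset msupp p <= s} ->
  linext p = \sum_(m <- s) p@_m *: F m.
Proof.
move=> s_uniq sub; rewrite [RHS](bigID (mem (msupp p))) /= [X in _ + X]big1 => [|m].
  rewrite addr0 -[RHS]big_filter; apply/perm_big/uniq_perm.
  - exact: msupp_uniq.
  - exact: filter_uniq.
  - by move=> m; rewrite mem_filter; case: (boolP (m \in msupp p)) => // /sub->.
by move/memN_msupp_eq0 ->; rewrite scale0r.
Qed.

Lemma linext_is_linear : linear linext.
Proof.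
move=> a p q; pose s := undup (msupp (a *: p + q) ++ msupp p ++ msupp q).
have sub r : r \in [:: a *: p + q; p; q] ->
    linext r = \sum_(m <- s) r@_m *: F m.
  move=> r_in; apply: linextE; first exact: undup_uniq.
  move=> m mr; rewrite mem_undup !mem_cat.
  by move: r_in mr; rewrite !inE => /or3P[]/eqP-> ->; rewrite ?orbT.
rewrite !sub ?inE ?eqxx ?orbT // scaler_sumr -big_split /=.
by apply: eq_bigr => m _; rewrite mcoeffD mcoeffZ scalerDl scalerA.
Qed.

HB.instance Definition _ := GRing.isLinear.Build rat P P *:%R linext linext_is_linear.

Lemma linextX m : linext 'X_[m] = F m.
Proof. by rewrite /linext msuppX big_seq1 mcoeffX eqxx scale1r. Qed.

Lemma linext_supported A A' p : (forall m, A m -> supported A' (F m)) ->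
  supported A p -> supported A' (linext p).
Proof.
move=> AF; elim/supported_ind=> [|a q r|m Am].
- by rewrite linear0; apply: supported0.
- by rewrite linearP; apply: supported_lin.
- by rewrite linextX; apply: AF.
Qed.

End LinearExtension.

Lemma linear_ext (f g : {linear P -> P}) A p :
  (forall m, A m -> f 'X_[m] = g 'X_[m]) -> supported A p -> f p = g p.
Proof.
move=> fg; elim/supported_ind=> [|a q r fq fr|m /fg//]; first by rewrite !linear0.
by rewrite !linearP fq fr.
Qed.

(** Of the sets of [j.+1] variables in the elementary symmetric polynomial, [top m j.+1] yields the
    raise and every other one a lower monomial. *)
Lemma mesymX_raise m (j : 'I_n) :
  supported (fun m' => lower m' (raise j.+1 m)) (e j.+1 * 'X_[m] - 'X_[raise j.+1 m]).
Proof.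
have cT : #|top m j.+1| = j.+1 by rewrite card_top; apply/minn_idPl.
rewrite mesymE (bigD1 (top m j.+1)) ?cT //= mulrDl -mpolyXD addmC.
rewrite -/(add_set m _) -/(raise _ m) addrAC subrr add0r mulr_suml.
apply: supported_sum => U /andP[/eqP cU neU]; rewrite -mpolyXD addmC.
apply: supportedX; apply: lower_add_set => //; by rewrite cT.
Qed.

(** Unitriangularity: multiplication by an elementary symmetric polynomial turns the leading
    monomial into its raise, and raising preserves [lower]. *)
Lemma garsia_lower m : supported (fun m' => lower m' m) (garsia m - 'X_[m]).
Proof.
elim/good_ind: m => [m /garsia_good->|m j IHm].
  by rewrite subrr; apply: supported0.
rewrite -garsia_raise.
have -> : e j.+1 * garsia m - 'X_[raise j.+1 m] =
  1 *: (e j.+1 * 'X_[m] - 'X_[raise j.+1 m]) + e j.+1 * (garsia m - 'X_[m]).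
  by rewrite scale1r mulrBr [RHS]addrC addrA subrK.
apply: supported_lin; first exact: mesymX_raise.
move: IHm; elim/supported_ind=> [|a p q lp lq|m' lm'].
- by rewrite mulr0; apply: supported0.
- by rewrite mulrDr -scalerAr; apply: supported_lin.
rewrite -[_ * _](addrNK 'X_[raise j.+1 m']) -[_ - _]scale1r.
have lr := lower_raise j.+1 lm'.
apply: supported_lin; last exact: supportedX.
by apply: supportedW _ (@mesymX_raise m' j) => m1 /lower_trans; apply.
Qed.

(** The unitriangular system is inverted by induction on [lower_measure]. *)
Lemma straighten_ex m : exists q,
  linext (@garsia n) q = 'X_[m] /\ supported (fun m' => lower m' m) (q - 'X_[m]).
Proof.
have [d] := ubnP (lower_measure m); elim: d m => // d IHd m lt_md.
have [q [qE lq]] : exists q, linext (@garsia n) q = garsia m - 'X_[m] /\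
    supported (fun m' => lower m' m) q.
  have := @garsia_lower m.
  elim/supported_ind=> [|a p q [p' [<- lp]] [q' [<- lq]]|m' lm'].
  - by exists 0; rewrite linear0; split=> //; apply: supported0.
  - by exists (a *: p' + q'); rewrite linearP; split=> //; apply: supported_lin.
  have [q [qE lq]] := IHd m' (leq_trans (lower_measure_lt lm') lt_md).
  exists q; split=> //; rewrite -(addrNK 'X_[m'] q) -[q - _]scale1r.
  apply: supported_lin; last exact: supportedX.
  by apply: supportedW _ lq => m1 /lower_trans; apply.
exists ('X_[m] - q); rewrite linearB /= qE linextX subKr; split=> //.
rewrite addrAC subrr add0r -scaleN1r -[_ *: _]addr0.
by apply: supported_lin; last exact: supported0.
Qed.

Lemma msupp_argmax (h : 'X_{1..n} -> nat) p : p != 0 -> exists2 m, m \in msupp p &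
  forall m', m' \in msupp p -> (h m' <= h m)%N.
Proof.
rewrite -msupp_eq0; case pE: (msupp p) => [//|m0 s] _; rewrite -pE.
have m0p : m0 \in msupp p by rewrite pE mem_head.
case: (@arg_maxnP _ (SeqSub m0p) predT (fun i => h (val i))) => // i _ maxi.
by exists (val i); [exact: valP | move=> m' m'p; apply: (maxi (SeqSub m'p))].
Qed.

(** A monomial of the support with largest [lower_measure] occurs in no other [garsia m'] of the
    combination, so its coefficient survives. *)
Lemma garsia_inj p : linext (@garsia n) p = 0 -> p = 0.
Proof.
move=> gp0; have [//|nz] := eqVneq p 0.
have [m mp maxm] := msupp_argmax (@lower_measure n) nz.
have := congr1 (mcoeff m) gp0; rewrite raddf_sum (bigD1_seq m) ?msupp_uniq //=.
have garsiaE m' : m' \in msupp p -> (garsia m')@_m = (m' == m)%:R.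
  move=> m'p; rewrite -[garsia m'](addrNK 'X_[m']) mcoeffD mcoeffX.
  rewrite memN_msupp_eq0 ?add0r //; apply/negP=> /garsia_lower/lower_measure_lt.
  by rewrite ltnNge maxm.
rewrite big_seq_cond big1 => [|m' /andP[m'p ne']]; last first.
  by rewrite mcoeffZ garsiaE // (negbTE ne') mulr0.
rewrite mcoeffZ garsiaE // eqxx mulr1 addr0 mcoeff0 => /eqP.
by rewrite mcoeff_eq0 mp.
Qed.

(* [gcoord p] lists the coordinates of [p] in the basis [garsia]:
   the coefficient of [garsia m] is that of ['X_[m]] in [gcoord p]. *)
Definition gcoord := linext (fun m => projT1 (cid (straighten_ex m))).

HB.instance Definition _ := GRing.Linear.on gcoord.

Lemma gcoordK p : linext (@garsia n) (gcoord p) = p.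
Proof.
apply: (linear_ext (f := linext (@garsia n) \o gcoord) (g := idfun)
  (A := fun=> True)) => // m _.
by rewrite /= /gcoord linextX; case: cid => q [].
Qed.


Lemma linextK p : gcoord (linext (@garsia n) p) = p.
Proof.
apply/eqP; rewrite -subr_eq0; apply/eqP/garsia_inj.
by rewrite linearB /= gcoordK subrr.
Qed.

Lemma gcoord_garsia m : gcoord (garsia m) = 'X_[m].
Proof. by rewrite -linextX linextK. Qed.

(** * The symmetric ideal in Garsia-Stanton coordinates *)

Lemma mesym_const0 (j : 'I_n) : (e j.+1)@_0%MM = 0.
Proof.
by apply: (@dhomog_nemf_coeff _ _ mdeg j.+1) => /=; rewrite ?dhomog_mesym ?mdeg0.
Qed.

(** Multiples are built in, so that generators of the ideal can be treated one at a time. The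
    constant term is carried along for [symmetric_in_bad_span]. *)
Definition in_bad_span p := p@_0%MM = 0 /\
  forall c, supported (fun m => ~~ good m) (gcoord (c * p)).

Lemma in_bad_span0 : in_bad_span 0.
Proof.
by split=> [|c]; rewrite ?mcoeff0 // mulr0 linear0; apply: supported0.
Qed.

Lemma in_bad_span_lin a p q :
  in_bad_span p -> in_bad_span q -> in_bad_span (a *: p + q).
Proof.
case=> p0 bp [q0 bq]; split=> [|c].
  by rewrite mcoeffD mcoeffZ p0 q0 mulr0 addr0.
by rewrite mulrDr -scalerAr linearP; apply: supported_lin.
Qed.

(** In coordinates the multiplication is [raise], whose values are never good. *)
Lemma mesym_in_bad_span (j : 'I_n) p : in_bad_span (e j.+1 * p).
Proof.
split=> [|c]; first by rewrite rmorphM /= mesym_const0 mul0r.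
rewrite mulrCA -[c * p]gcoordK.
have : supported (fun=> True) (gcoord (c * p)) by [].
elim/supported_ind=> [|a q r bq br|].
- by rewrite linear0 mulr0 linear0; apply: supported0.
- by rewrite linearP mulrDr -scalerAr linearP; apply: supported_lin.
move=> m _; rewrite linextX garsia_raise gcoord_garsia.
by apply: supportedX; apply: good_raise.
Qed.

Lemma comp_mesym_in_bad_span p :
  in_bad_span (p \mPo [tuple e i.+1 | i < n] - (p@_0%MM)%:MP).
Proof.
have : supported (fun=> True) p by [].
elim/supported_ind=> [|a q r bq br|m _].
- by rewrite linear0 mcoeff0 mpolyC0 subr0; apply: in_bad_span0.
- rewrite linearP mcoeffD mcoeffZ mpolyCD mpolyCM mul_mpolyC opprD addrACA.
  by rewrite -scalerBr; apply: in_bad_span_lin.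
rewrite comp_mpolyX mcoeffX; case: eqVneq => [->|ne].
  by rewrite big1 ?subrr ?mpolyC1 => [|i _]; [apply: in_bad_span0 | rewrite mnm0E].
have [j mj] : exists j, m j != 0%N.
  apply/existsP; apply: contraR ne => /existsPn m0.
  by apply/eqP/mnmP=> i; rewrite mnm0E; apply/eqP/negPn/m0.
rewrite mpolyC0 subr0 (bigD1 j) //= tnth_mktuple.
by rewrite -(prednK (n := m j)) ?lt0n // exprS -mulrA; apply: mesym_in_bad_span.
Qed.

(** By the fundamental theorem [p] is a polynomial [t] in the elementary symmetric ones; the
    constant term clause shows that [t] has no constant term either. *)
Lemma symmetric_in_bad_span p : p \is symmetric -> p@_0%MM = 0 -> in_bad_span p.
Proof.
case/sym_fundamental=> t [<- _] t0; have bt := comp_mesym_in_bad_span t.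
have [] := bt; rewrite mcoeffB mcoeffC eqxx mulr1 t0 sub0r => /eqP.
by rewrite oppr_eq0 => /eqP e0 _; move: bt; rewrite e0 mpolyC0 subr0.
Qed.

Lemma gcoord_ideal p : p \in @sym_ideal_pred n ->
  supported (fun m => ~~ good m) (gcoord p).
Proof.
case/asboolP=> s [sP ->]; rewrite linear_sum big_seq.
apply: supported_sum => cf /sP[sym0 cf0].
exact: (symmetric_in_bad_span sym0 cf0).2.
Qed.

(** Together with [gcoord_ideal], this makes the ideal the span of the [garsia m] with [m] not
    good. *)
Lemma garsia_ideal m : ~~ good m -> garsia m \in @sym_ideal_pred n.
Proof.
case/not_goodP=> j [m' ->]; rewrite -garsia_raise; apply/asboolP.
exists [:: (garsia m', e j.+1)]; rewrite big_seq1 mulrC; split=> // cf.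
by rewrite inE => /eqP-> /=; rewrite mesym_sym mesym_const0.
Qed.

End Polynomials.

(** * Components by exponent partition *)

Section Components.

Variable n : nat.
Local Open Scope ring_scope.
Local Notation P := {mpoly rat[n]}.
Local Notation I := (@sym_ideal_pred n).
Implicit Types (m : 'X_{1..n}) (p q : P) (la mu : part n) (D : pred 'X_{1..n}).

Definition keep D := linext (fun m => if D m then 'X_[m] : P else 0).

HB.instance Definition _ D := GRing.Linear.on (keep D).

Lemma keepX D m : keep D 'X_[m] = if D m then 'X_[m] else 0.
Proof. exact: linextX. Qed.

Lemma keep_supported D A p : supported A p ->
  supported (fun m => D m /\ A m) (keep D p).
Proof.
apply: linext_supported => m Am; case: ifP => [Dm|_]; last exact: supported0.
exact: supportedX.
Qed.

Lemma keep_id D p : supported D p -> keep D p = p.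
Proof.
apply: (linear_ext (f := keep D) (g := idfun)) => m Dm.
by rewrite /= keepX Dm.
Qed.

Lemma keep0 D p : supported (fun m => ~~ D m) p -> keep D p = 0.
Proof.
apply: (linear_ext (f := keep D) (g := \0)) => m /negbTE Dm.
by rewrite /= keepX Dm.
Qed.

Lemma subr_keep D p : p - keep D p = keep (predC D) p.
Proof.
apply: (linear_ext (f := idfun \- keep D) (g := keep (predC D))
  (A := fun=> True)) => // m _.
by rewrite /= !keepX /=; case: (D m); rewrite ?subrr ?subr0.
Qed.

Lemma supported_trivial p : supported (fun=> True) p.
Proof. by []. Qed.

(** A good [garsia m] is the monomial itself and the others lie in the ideal, so the good
    coordinates, read as a polynomial, represent [p]. *)
Lemma keep_coord_congr p : p - keep (@good n) (gcoord p) \in I.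
Proof.
rewrite -{1}[p]gcoordK; elim/supported_ind: (@supported_trivial (gcoord p)).
- by rewrite !linear0 addr0 rpred0.
- move=> a q r Iq Ir; rewrite !linearP addrACA -scalerDr.
  by rewrite rpredD // sym_ideal_scale.
move=> m _; rewrite linextX keepX; case: ifPn => [/garsia_good->|/garsia_ideal].
  by rewrite subrr rpred0.
by rewrite subr0.
Qed.

Lemma gcoord_supported A p : (forall m m', lower m' m -> A m -> A m') ->
  supported A p -> supported A (gcoord p).
Proof.
move=> Alow; apply: linext_supported => m Am; case: cid => q [_ lq] /=.
rewrite -(addrNK 'X_[m] q) -[q - _]scale1r.
apply: supported_lin; last exact: supportedX.
by apply: supportedW _ lq => m' /Alow; apply.
Qed.

Lemma gcoord_good p : supported (@good n) p -> gcoord p = p.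
Proof.
apply: (linear_ext (f := @gcoord n) (g := idfun)) => m /garsia_good gm.
by rewrite /= -{1}gm gcoord_garsia.
Qed.

(** The projection onto the good monomials of partition [la], along the other elements of the basis
    [garsia]. *)
Definition component la p := keep (fun m => good m && (exp_part m == la)) (gcoord p).

HB.instance Definition _ la :=
  GRing.isLinear.Build rat P P *:%R (component la)
    (linearP (keep (fun m => good m && (exp_part m == la)) \o @gcoord n)).

Lemma component_good la p : supported (@good n) p ->
  component la p = keep (fun m => exp_part m == la) p.
Proof.
move=> gp; rewrite /component gcoord_good //; move: gp.
apply: (linear_ext (f := keep (fun m => good m && (exp_part m == la)))
  (g := keep (fun m => exp_part m == la))) => m gm.
by rewrite /= !keepX gm.
Qed.

Lemma component_ideal la p : p \in I -> component la p = 0.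
Proof.
move=> /gcoord_ideal bp; apply: keep0; apply: supportedW _ bp => m /negbTE->.
by [].
Qed.

(** Straightening only goes down in dominance order, so it cannot reach [la] from below [mu]. *)
Lemma component0 la mu p : supported (fun m => dominated (exp_part m) mu) p ->
  ~~ dominated la mu -> component la p = 0.
Proof.
move=> dp nd; apply: keep0.
apply: (supportedW (A := fun m => dominated (exp_part m) mu)) => [m dm|].
  by apply: contra nd => /andP[_ /eqP<-].
apply: gcoord_supported dp => m m' /lower_dominated low; exact: dominated_trans low.
Qed.

Lemma component_strict0 la p :
  supported (fun m => strictly_dominated (exp_part m) la) p -> component la p = 0.
Proof.
elim/supported_ind=> [|a q r q0 r0|m /andP[ne dm]]; first exact: linear0.
  by rewrite linearP /= q0 r0 scaler0 addr0.
have dX : supported (fun m' => dominated (exp_part m') (exp_part m)) ('X_[m] : P).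
  by apply: supportedX; apply: dominated_refl.
apply: component0 dX _; apply: contra ne => dm'.
rewrite -(dominated_height dm).2 eqn_leq.
by rewrite (dominated_height dm).1 (dominated_height dm').1.
Qed.

Lemma component_exp_part la p :
  supported (fun m => good m /\ exp_part m = la) (component la p).
Proof.
have := keep_supported (D := fun m => good m && (exp_part m == la))
  (@supported_trivial (gcoord p)).
by apply: supportedW => m [/andP[gm /eqP]].
Qed.

(** The good coordinates of [p] have partition [la] or a strictly dominated one; the latter make up
    [q]. *)
Lemma component_congr la p : supported (fun m => dominated (exp_part m) la) p ->
  exists2 q, supported (fun m => strictly_dominated (exp_part m) la) q &
    p - component la p - q \in I.
Proof.
move=> dp; exists (keep (fun m => good m && (exp_part m != la)) (gcoord p)).
  have dc : supported (fun m => dominated (exp_part m) la) (gcoord p).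
    apply: gcoord_supported dp => m m' /lower_dominated low.
    exact: dominated_trans low.
  by apply: supportedW _ (keep_supported dc) => m [/andP[_ ne] dm]; apply/andP.
rewrite -addrA -opprD; suff -> : component la p +
    keep (fun m => good m && (exp_part m != la)) (gcoord p) =
    keep (@good n) (gcoord p).
  exact: keep_coord_congr.
rewrite /component; elim/supported_ind: (@supported_trivial (gcoord p)).
- by rewrite !linear0 addr0.
- by move=> a q r eq er; rewrite !linearP addrACA -scalerDr eq er.
move=> m _; rewrite !keepX; case: (good m) => /=; last by rewrite addr0.
by case: eqP => _ /=; rewrite ?addr0 ?add0r.
Qed.

Lemma monom_spanP (D : pred (part n)) p :
  (p \in monom_span D) <-> supported (fun m => D (exp_part m)) p.
Proof.
split=> [/asboolP[s [sD ->]]|Dp].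
  rewrite big_seq; apply: supported_sum => cx /sD[m Dm ->]; rewrite -[_ *: _]addr0.
  by apply: supported_lin; [apply: supportedX | apply: supported0].
apply/asboolP; exists [seq (p@_m, 'X_[m] : poly_rep n) | m <- msupp p].
by rewrite big_map -mpolyE; split=> // cx /mapP[m /Dp Dm ->]; exists m.
Qed.

Lemma homog_subrepP k p :
  p \in homog_subrep n k <-> supported (fun m => mdeg m = k) p.
Proof. by split=> [/dhomogP|/dhomogP]. Qed.

End Components.

(** * Representations *)

Section RepresentationTheory.

Variables (F : fieldType) (gT : finGroupType).
Local Open Scope ring_scope.
Implicit Types M N : repType F gT.

Definition rep_op M g (x : M) : M := rep_act M x g.

HB.instance Definition _ M g :=
  GRing.isLinear.Build F M M *:%R (@rep_op M g) (rep_act_linear g).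

Definition comp_fun M N L (f : rep_hom M N) (g : rep_hom N L) :
  {linear M -> L} := g \o f.

Lemma comp_funJ M N L (f : rep_hom M N) (g : rep_hom N L) x h :
  comp_fun f g (rep_act M x h) = rep_act L (comp_fun f g x) h.
Proof. by rewrite /= !rep_homJ. Qed.

Definition comp_hom M N L (f : rep_hom M N) (g : rep_hom N L) : rep_hom M L :=
  RepHom (comp_funJ f g).

(** * Averaging over the group *)

Section Average.

Variables (M N : repType F gT) (f : {linear M -> N}).

Definition average (x : M) : N :=
  #|gT|%:R^-1 *: \sum_g rep_act N (f (rep_act M x g)) g^-1%g.

Lemma average_is_linear : linear average.
Proof.
move=> a x y; rewrite /average scalerA mulrC -scalerA -scalerDr; congr (_ *: _).
rewrite scaler_sumr -big_split; apply: eq_bigr => g _ /=.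
by rewrite rep_act_linear linearP rep_act_linear.
Qed.

HB.instance Definition _ := GRing.isLinear.Build F M N *:%R average average_is_linear.

Lemma averageJ x h : average (rep_act M x h) = rep_act N (average x) h.
Proof.
rewrite /average -[RHS]/(rep_op h _) linearZ; congr (_ *: _).
rewrite linear_sum [RHS](reindex_inj (mulgI h)) /=.
apply: eq_bigr => g _.
by rewrite /rep_op -!rep_actM invMg mulgKV.
Qed.

Definition average_hom : rep_hom M N := RepHom averageJ.

(** Commutation is asked at the vector [x] only, to suit a map known to be equivariant on just a
    part of its domain. *)
Lemma average_id x : #|gT|%:R != 0 :> F ->
  (forall g, f (rep_act M x g) = rep_act N (f x) g) -> average x = f x.
Proof.
move=> nz fJ; rewrite /average (eq_bigr (fun=> f x)) => [|g _].
  by rewrite sumr_const -[#|_|]/#|gT| -scaler_nat scalerA mulVf ?scale1r.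
by rewrite fJ -rep_actM mulgV rep_act1.
Qed.

Lemma average0 x : (forall g, f (rep_act M x g) = 0) -> average x = 0.
Proof.
by move=> f0; rewrite /average big1 ?scaler0 // => g _; rewrite f0 rep_act0.
Qed.

End Average.

(** * Quotients and subquotients *)

Section QuotLift.

Variables (M N : repType F gT) (U : subrep M) (f : {linear M -> N}).
Hypothesis f0 : forall x, x \in subrep_pred U -> f x = 0.

(** The proof that [f] kills [U] is an argument, so that the linear structure, which depends on it,
    can be attached. *)
Definition quot_lift of (forall x, x \in subrep_pred U -> f x = 0) :=
  fun x : quot_rep U => f (repr x).

Lemma quot_liftE x : quot_lift f0 (quot_proj U x) = f x.
Proof.
apply/eqP; rewrite -subr_eq0 -linearB; apply/eqP/f0/quot_piP; exact: quot_reprK.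
Qed.

Lemma quot_lift_is_linear : linear (quot_lift f0).
Proof.
move=> a x y; rewrite -[x]quot_reprK -[y]quot_reprK.
rewrite -[LHS]/(quot_lift f0 (a *: quot_proj U (repr x) + quot_proj U (repr y))).
by rewrite -linearP !quot_liftE linearP.
Qed.

HB.instance Definition _ :=
  GRing.isLinear.Build F (quot_rep U) N *:%R (quot_lift f0)
    quot_lift_is_linear.

End QuotLift.

Section Subquotient.

Variables (M : repType F gT) (U W : subrep M).

Definition subquot_class x (Ux : x \in subrep_pred U) : subquot_rep U W :=
  quot_proj (preim_subrep (sub_incl U) W) (SubSort Ux).

Lemma subquot_classP x y (Ux : x \in subrep_pred U) (Uy : y \in subrep_pred U) :
  subquot_class Ux = subquot_class Uy <-> x - y \in subrep_pred W.
Proof. by split=> [/quot_piP|Wxy]; last apply/quot_piP. Qed.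

Lemma subquot_class0 x (Ux : x \in subrep_pred U) :
  subquot_class Ux = 0 <-> x \in subrep_pred W.
Proof.
have U0 : 0 \in subrep_pred U by rewrite rpred0.
have -> : 0 = subquot_class U0.
  rewrite /subquot_class -(linear0 (quot_proj _)).
  by congr (quot_proj _ _); apply/val_inj.
by rewrite subquot_classP subr0.
Qed.

Lemma subquot_class_lin a x y (Ux : x \in subrep_pred U) (Uy : y \in subrep_pred U)
    (Uz : a *: x + y \in subrep_pred U) :
  subquot_class Uz = a *: subquot_class Ux + subquot_class Uy.
Proof.
by rewrite /subquot_class -linearP; congr (quot_proj _ _); apply/val_inj.
Qed.

Lemma subquot_classJ x g (Ux : x \in subrep_pred U)
    (Uxg : rep_act M x g \in subrep_pred U) :
  subquot_class Uxg = rep_act (subquot_rep U W) (subquot_class Ux) g.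
Proof.
rewrite /subquot_class -rep_homJ; congr (quot_proj _ _).
exact/val_inj.
Qed.

Lemma subquot_class_onto c :
  exists x (Ux : x \in subrep_pred U), c = subquot_class Ux.
Proof.
exists (sub_val (repr c)), (sub_valP (repr c)); rewrite -[LHS]quot_reprK.
by rewrite /subquot_class; congr quot_pi; apply/val_inj.
Qed.

End Subquotient.

(** Back substitution from the greatest height down: a lift at [i] disturbs only components of
    smaller height. The induction is on a bound [b] from which on [y] vanishes. *)
Lemma triangular_surj (V : lmodType F) (I : finType) (N : I -> lmodType F)
    (f : forall i, {linear V -> N i}) (h : I -> nat) :
  (forall i (c : N i), exists x, f i x = c /\
     forall j, j != i -> (h i <= h j)%N -> f j x = 0) ->
  forall y : (forall i, N i), exists x, forall i, f i x = y i.
Proof.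
move=> lift y.
have [b y0] : exists b, forall i, (b <= h i)%N -> y i = 0.
  exists (\max_i h i).+1 => i; rewrite ltnNge leq_bigmax //.
elim: b y y0 => [|b IHb] y y0; first by exists 0 => i; rewrite linear0 y0.
have /choice[x xP] i := lift i (y i).
pose x0 := \sum_(i | h i == b) x i.
have [|z zE] := IHb (fun i => y i - f i x0).
  move=> i; rewrite leq_eqVlt linear_sum => /predU1P[bE|lt_b].
    rewrite (bigD1 i) -?bE //= (xP i).1 big1 ?addr0 ?subrr // => j /andP[/eqP hj ji].
    by apply: (xP j).2; rewrite 1?eq_sym // hj bE.
  rewrite y0 // big1 ?subrr // => j /eqP hj; apply: (xP j).2; last by rewrite hj ltnW.
  by apply: contraTneq lt_b => ->; rewrite hj ltnn.
by exists (z + x0) => i; rewrite linearD zE subrK.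
Qed.

Section HomToSum.

Variables (M : repType F gT) (I : finType) (N : I -> repType F gT).
Variable f : forall i, rep_hom M (N i).

Definition sum_map (x : M) : dsum_rep N := [ffun i => f i x].

Lemma sum_map_is_linear : linear sum_map.
Proof. by move=> a x y; apply/ffunP=> i; rewrite !ffunE linearP. Qed.

HB.instance Definition _ :=
  GRing.isLinear.Build F M (dsum_rep N) *:%R sum_map sum_map_is_linear.

Lemma sum_mapJ x g : sum_map (rep_act M x g) = rep_act (dsum_rep N) (sum_map x) g.
Proof. by apply/ffunP=> i; rewrite !ffunE rep_homJ. Qed.

Lemma rep_iso_dsum : (forall x, (forall i, f i x = 0) -> x = 0) ->
  (forall y : (forall i, N i), exists x, forall i, f i x = y i) ->
  rep_iso M (dsum_rep N).
Proof.
move=> inj surj; exists (RepHom sum_mapJ).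
have /choice[g gP] (y : dsum_rep N) : exists x, sum_map x = y.
  by have [x xE] := surj y; exists x; apply/ffunP=> i; rewrite ffunE xE.
exists g => // x; apply/eqP; rewrite -subr_eq0; apply/eqP/inj => i.
have /ffunP/(_ i) := gP (sum_map x); rewrite !ffunE => e.
by rewrite linearB /= e subrr.
Qed.

End HomToSum.

End RepresentationTheory.

(** * The isomorphism *)

Section Coinvariants.

Variable n : nat.
Local Open Scope ring_scope.
Local Notation P := {mpoly rat[n]}.
Local Notation I := (@sym_ideal_pred n).
Implicit Types (m : 'X_{1..n}) (p q : poly_rep n) (la mu : part n) (S : {set 'I_n}).

Lemma psi_eq0 p : psi n p = 0 <-> p \in I.
Proof.
rewrite -(linear0 (psi n)).
by split=> [/quot_piP|Ip]; last apply/quot_piP; rewrite subr0.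
Qed.

Lemma psi_eq p q : psi n p = psi n q <-> p - q \in I.
Proof.
rewrite -psi_eq0 linearB; split=> [->|/eqP]; first exact: subrr.
by rewrite subr_eq0 => /eqP.
Qed.

Lemma PdomP la p : p \in Pdom la <-> supported (fun m => dominated (exp_part m) la) p.
Proof. exact: monom_spanP. Qed.

Lemma PsdomP la p :
  p \in Psdom la <-> supported (fun m => strictly_dominated (exp_part m) la) p.
Proof. exact: monom_spanP. Qed.

Lemma psi_PdomP la p : supported (fun m => dominated (exp_part m) la) p ->
  psi n p \in subrep_pred (im_subrep (psi n) (Pdom la)).
Proof. by move=> dp; apply/asboolP; exists p => //; apply/PdomP. Qed.

Lemma component_Pdom la p :
  psi n (component la p) \in subrep_pred (im_subrep (psi n) (Pdom la)).
Proof.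
apply: psi_PdomP; apply: supportedW _ (@component_exp_part _ la p) => m [_ ->].
exact: dominated_refl.
Qed.

(** * Equivariant projections onto the subquotients *)

Definition top_class la p : Rpart la :=
  subquot_class (im_subrep (psi n) (Psdom la)) (component_Pdom la p).

Lemma top_class_is_linear la : linear (@top_class la).
Proof.
move=> a p q; rewrite /top_class -subquot_class_lin => [|Uz].
  by rewrite rpredD // ?rpredZ // component_Pdom.
by apply/subquot_classP; rewrite [component _ _]linearP [psi n _]linearP subrr rpred0.
Qed.

HB.instance Definition _ la :=
  GRing.isLinear.Build rat (poly_rep n) (Rpart la) *:%R (@top_class la)
    (@top_class_is_linear la).

Lemma top_class_ideal la p : p \in subrep_pred (sym_ideal n) -> top_class la p = 0.
Proof.
by move=> Ip; apply/subquot_class0; rewrite component_ideal // linear0 rpred0.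
Qed.

(** Modulo the ideal, [p] and its component differ by an element of [Psdom la]. *)
Lemma top_class_Pdom la p
    (Up : psi n p \in subrep_pred (im_subrep (psi n) (Pdom la))) :
  p \in Pdom la -> top_class la p = subquot_class _ Up.
Proof.
move=> /PdomP/component_congr[q sq Iq]; apply/subquot_classP/asboolP.
exists (- q); first by rewrite rpredN; apply/PsdomP.
rewrite -linearB; apply/psi_eq.
by rewrite -rpredN !opprD !opprK addrC [- _ + p]addrC addrC.
Qed.

Definition theta la : rep_hom (coinv n) (Rpart la) :=
  average_hom (quot_lift (@top_class_ideal la)).

Lemma quot_lift_psi la p : quot_lift (@top_class_ideal la) (psi n p) = top_class la p.
Proof. exact: quot_liftE. Qed.

(** The support condition is stable under permutations, so every term of the average vanishes. *)
Lemma theta0 la mu p : supported (fun m => dominated (exp_part m) mu) p ->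
  ~~ dominated la mu -> theta la (psi n p) = 0.
Proof.
move=> dp nd; apply: average0 => g; rewrite -rep_homJ [LHS]quot_lift_psi.
apply/subquot_class0; rewrite (@component0 _ _ mu) ?linear0 ?rpred0 //.
by apply/PdomP/subrep_stable/PdomP.
Qed.

(** On [Pdom la] the map [top_class la] is the canonical projection, already equivariant, so
    averaging leaves it unchanged. *)
Lemma theta_Pdom la p (Up : psi n p \in subrep_pred (im_subrep (psi n) (Pdom la))) :
  p \in Pdom la -> theta la (psi n p) = subquot_class _ Up.
Proof.
move=> dp; rewrite -top_class_Pdom // -quot_lift_psi.
apply: average_id => [|g].
  by rewrite Num.Theory.pnatr_eq0 -lt0n; apply/card_gt0P; exists 1%g.
have dpg : rep_act (poly_rep n) p g \in Pdom la by apply: subrep_stable.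
have Upg : psi n (rep_act (poly_rep n) p g) \in
    subrep_pred (im_subrep (psi n) (Pdom la)).
  by apply: psi_PdomP; apply/PdomP.
rewrite -rep_homJ [LHS]quot_lift_psi [X in _ = rep_act _ X _]quot_lift_psi.
rewrite (top_class_Pdom Upg) // (top_class_Pdom Up) //.
rewrite -subquot_classJ => [|Upg']; first by rewrite -rep_homJ.
by apply/subquot_classP; rewrite rep_homJ subrr rpred0.
Qed.

Lemma theta_class la (c : Rpart la) : exists p,
  supported (fun m => dominated (exp_part m) la) p /\ theta la (psi n p) = c.
Proof.
have [x [Ux ->]] := subquot_class_onto c.
have /asboolP[p dp xE] := Ux; exists p; split; first exact/PdomP.
have Up : psi n p \in subrep_pred (im_subrep (psi n) (Pdom la)) by rewrite -xE.
by rewrite (theta_Pdom Up) //; apply/subquot_classP; rewrite xE subrr rpred0.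
Qed.

Lemma theta_eq0 la p : supported (fun m => dominated (exp_part m) la) p ->
  theta la (psi n p) = 0 -> component la p = 0.
Proof.
move=> dp; rewrite (theta_Pdom (psi_PdomP dp)); last exact/PdomP.
move=> /subquot_class0/asboolP[q /PsdomP sq /psi_eq Ipq].
by rewrite -(subrK q p) linearD /= component_ideal // component_strict0 ?addr0.
Qed.


(** * Joint bijectivity in degree [k] *)

Lemma coinv_homog_deg k (x : coinv_homog n k) : exists2 p,
  supported (fun m => mdeg m = k) p & sub_val x = psi n p.
Proof. by have /asboolP[p /homog_subrepP hp xE] := sub_valP x; exists p. Qed.

(** In a representative [q] made of good monomials, let [la] be a partition of greatest height. Then
    [theta la] sees only the part [q1] of [q] with partition [la], on which it is injective, so a
    nonzero [q] is detected. *)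
Lemma theta_joint_inj k (x : coinv_homog n k) :
  (forall S, S \in subsets_of_sum n k -> theta (subset_part S) (sub_val x) = 0) ->
  x = 0.
Proof.
have [p hp xE] := coinv_homog_deg x => th0; apply: val_inj; rewrite /= xE.
pose q := keep (@good n) (gcoord p).
have /psi_eq-> := keep_coord_congr p; rewrite -/q.
have /psi_eq pq := keep_coord_congr p.
have gq : supported (fun m => good m /\ mdeg m = k) q.
  apply: keep_supported; apply: gcoord_supported hp => m m' [-> //].
have [->|nz] := eqVneq q 0; first by rewrite linear0.
have [m mq maxm] := msupp_argmax (fun m => height (exp_part m)) nz.
have [gm dm] := gq m mq; have [S Sn SE] := good_exp_part gm.
have Sk : S \in subsets_of_sum n k.
  rewrite inE -sumn_subset_part -SE sumn_exp_part dm eqxx andbT.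
  by apply/forall_inP.

have := th0 S Sk; rewrite xE pq -SE -/q.
set la := exp_part m in maxm *; set q1 := keep (fun m' => exp_part m' == la) q.
have q2E := subr_keep (fun m' => exp_part m' == la) q; rewrite -/q1 in q2E.
have q2_supp : supported (fun m' => exp_part m' != la /\ m' \in msupp q) (q - q1).
  by rewrite q2E; apply: keep_supported.
have q1_supp : supported (fun m' => exp_part m' == la /\ good m') q1.
  by apply: keep_supported => m' /gq[].
rewrite -(subrK q1 q) [psi n _]linearD linearD /=.
(* By maximality of its height, [la] is dominated by no other partition occurring in [q]. *)
have -> : theta la (psi n (q - q1)) = 0.
  move: q2_supp; elim/supported_ind=> [|a u v u0 v0|m' [ne m'q]].
  - by rewrite !linear0.
  - by rewrite [psi n _]linearP linearP /= u0 v0 scaler0 addr0.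
  apply: (@theta0 _ (exp_part m')); first by apply: supportedX; apply: dominated_refl.
  apply: contra ne => /dominated_height h; rewrite eq_sym -h.2 eqn_leq h.1.
  exact: maxm.
have q1_la : supported (fun m' => dominated (exp_part m') la) q1.
  by apply: supportedW _ q1_supp => m' [/eqP-> _]; apply: dominated_refl.
rewrite add0r => /(theta_eq0 q1_la); rewrite component_good; last first.
  by apply: supportedW _ q1_supp => m' [].
rewrite keep_id => [q10|]; last by apply: supportedW _ q1_supp => m' [].
rewrite q10 subr0 in q2_supp.
by have [] := q2_supp m mq; rewrite eqxx.
Qed.

Lemma theta_joint_surj k 
    (y : forall s : {S : {set 'I_n} | S \in subsets_of_sum n k},
      Rpart (subset_part (val s))) :
  exists x : coinv_homog n k, forall s, theta (subset_part (val s)) (sub_val x) = y s.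
Proof.
pose f (s : {S : {set 'I_n} | S \in subsets_of_sum n k}) :
    {linear coinv_homog n k -> Rpart (subset_part (val s))} :=
  comp_fun (sub_incl _) (theta (subset_part (val s))).
apply: (triangular_surj (f := f) (h := fun s => height (subset_part (val s)))).
move=> s c; have [p [dp <-]] := theta_class c.
(* Monomials dominated by a partition have the same degree, here the sum of the subset, which is
   [k]. *)
have hp : psi n p \in subrep_pred (im_subrep (psi n) (homog_subrep n k)).
  apply/asboolP; exists p => //; apply/homog_subrepP.
  apply: supportedW _ dp => m /andP[/eqP]; rewrite sumn_exp_part => -> _.
  rewrite sumn_subset_part.
  by have := valP s; rewrite inE => /andP[_ /eqP].
exists (SubSort hp); split=> // s' ne le; apply: (theta0 dp).
(* Dominance against the order of heights would force equal partitions, hence equal subsets. *)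
apply: contra ne => /dominated_height h.
by rewrite -val_eqE -(inj_eq (@subset_part_inj n)) -h.2 eqn_leq h.1.
Qed.

End Coinvariants.

Theorem theorem3p12 (n k : nat) (hk : (k <= 'C(n, 2))%N) :
  rep_iso (coinv_homog n k)
    (dsum_rep (fun S : {S : {set 'I_n} | S \in subsets_of_sum n k} =>
       Rpart (subset_part (val S)))).
Proof.
apply: (rep_iso_dsum (f := fun S : {S | S \in subsets_of_sum n k} =>
  comp_hom (sub_incl _) (theta (subset_part (val S))))).
  by move=> x x0; apply: theta_joint_inj => S Sk; apply: (x0 (exist _ S Sk)).
exact: theta_joint_surj.
Qed.
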